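(* Let $2\le\alpha<\beta$ be coprime integers, $\Gamma=\langle\alpha,\beta\rangle$, and let $g=\alpha\beta-a\alpha-b\beta$ (with integers $a,b\ge1$) be a gap of $\Gamma$. Let $[h_0,h_1]$ denote the minimal system of generators of the $\Gamma$-semimodule $\mathrm{Syz}(\Delta_{[0,g]})$. Then $$-W(g)=\begin{cases} a\alpha-2ab & \text{if } \min\{h_0,h_1\}=\alpha\beta-b\beta,\\ b\beta-2ab & \text{if } \min\{h_0,h_1\}=\alpha\beta-a\alpha.\end{cases}$$
   Context: $\mathbb{N}$ contains $0$; $\Gamma=\{m\alpha+n\beta: m,n\in\mathbb{N}\}$; gaps are elements of $\mathbb{N}\setminus\Gamma$, and every gap is uniquely of the form $\alpha\beta-a\alpha-b\beta$ with integers $a,b\ge1$. A $\Gamma$-semimodule is a nonempty $\Delta\subseteq\mathbb{N}$ with $\Delta+\Gamma\subseteq\Delta$; it has a unique minimal system of generators, i.e. a minimal set $\mathcal{E}$ with $\Delta=\bigcup_{x\in\mathcal{E}}(\Gamma+x)$. Its conductor is $c(\Delta)=\max(\mathbb{N}\setminus\Delta)+1$ (with $c(\mathbb{N})=0$) and $\delta(\Delta)=|\{x\in\Delta: x<c(\Delta)\}|$. For a gap $g$, $\Delta_{[0,g]}=\Gamma\cup(\Gamma+g)$ is the $\Gamma$-semimodule minimally generated by $\{0,g\}$, its syzygy semimodule is $\mathrm{Syz}(\Delta_{[0,g]})=\Gamma\cap(\Gamma+g)$ (which is minimally generated by two elements), and the Wilf number of $g$ is $W(g)=2\delta(\Delta_{[0,g]})-c(\Delta_{[0,g]})$.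 *)

(* Defs.v *)
From mathcomp Require Import all_boot all_order all_algebra.
From mathcomp Require Import finmap.
From mathcomp Require Import classical_sets cardinality.

Set Implicit Arguments.
Unset Strict Implicit.
Unset Printing Implicit Defensive.

Import GRing.Theory Num.Theory.

Local Open Scope classical_set_scope.

Definition semigroup2 (alpha beta : nat) : set nat :=
  [set x | exists m n : nat, x = (m * alpha + n * beta)%N].

Definition gap (G : set nat) (g : nat) : Prop := ~ G g.

Definition translate (G : set nat) (x : nat) : set nat :=
  [set (y + x)%N | y in G].

Definition generates (G E D : set nat) : Prop :=
  D = \bigcup_(x in E) translate G x.

Definition minimal_generators (G E D : set nat) : Prop :=
  generates G E D /\
  forall F : set nat, F `<=` E -> generates G F D -> F = E.

(* [max (N \ D) + 1], and 0 when D is all of N.  [fset_set] is the empty set on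
   infinite sets, so this is only meaningful when N \ D is finite, which holds
   for the semimodules over a numerical semigroup. *)
Definition conductor (D : set nat) : nat :=
  (\max_(x <- fset_set (~` D)) x.+1)%N.

Definition delta (D : set nat) : nat :=
  #|` fset_set [set x | D x /\ (x < conductor D)%N] |%fset.

Definition Delta0 (G : set nat) (g : nat) : set nat := G `|` translate G g.

Definition Syz0 (G : set nat) (g : nat) : set nat := G `&` translate G g.

Definition wilf (G : set nat) (g : nat) : int :=
  (2 * (delta (Delta0 G g))%:Z - (conductor (Delta0 G g))%:Z)%R.

(* Main.v *)
Require Import Defs.
From mathcomp Require Import all_boot all_order all_algebra.
From mathcomp Require Import finmap.
From mathcomp Require Import classical_sets cardinality boolp.
From mathcomp Require Import zify.

(** The gaps of [Gamma = <alpha, beta>] are the naturals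
    [x = alpha beta - u alpha - v beta] with [u, v >= 1], and the pair [(u, v)]
    is unique ([gapP], [gap_coords_inj]).  Adding a multiple of [alpha] or
    [beta] lowers the corresponding coordinate, so a gap with coordinates
    [(u, v)] lies in [Gamma + g], where [g] has coordinates [(a, b)], exactly
    when [u <= a] and [v <= b].  Hence the complement of [Delta = Gamma U
    (Gamma + g)] consists of the gaps of [Gamma] whose coordinates lie outside
    the box [[1, a] x [1, b]] ([gap_Delta0P]).  This picture gives everything.

    Counting: the pairs [(u, v)] with [1 <= u < beta], [1 <= v < alpha] never
    satisfy [u alpha + v beta = alpha beta], and the central symmetry
    [(u, v) |-> (beta - u, alpha - v)] exchanges the two strict inequalities,
    so half of them are coordinates of gaps.  Removing the box leaves
    [n = (alpha - 1)(beta - 1)/2 - a b] elements outside [Delta]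
    ([card_gaps_Delta0]).

    Conductor: outside the box [u > a] or [v > b], so the largest value of
    [alpha beta - u alpha - v beta] is reached at [(a + 1, 1)] or [(1, b + 1)],
    whence [c = (alpha - 1)(beta - 1) - min (a alpha) (b beta)]
    ([Delta0_conductor]).

    Since [delta + n = c] ([delta_add_gaps]), the Wilf number satisfies
    [- W = c - 2 delta = 2 n - c = min (a alpha) (b beta) - 2 a b].

    Finally the smaller of the two generators of the syzygy semimodule is its
    least element, which is [g + min (a alpha) (b beta)] ([Syz0_min],
    [Syz0_min_mem]); so it tells which of [a alpha] and [b beta] is the
    minimum above. *)

Set Implicit Arguments.
Unset Strict Implicit.

(** * Coordinates of the gaps *)

Definition gap_coords (alpha beta x u v : nat) : Prop :=
  [/\ 0 < u, 0 < v & x + u * alpha + v * beta = alpha * beta].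

(** By coprimality [beta] divides [u], hence [u >= beta], and then
    [u * alpha] alone already exhausts [alpha * beta]. *)
Lemma mul_neq_pos_comb (alpha beta u v : nat) :
  coprime alpha beta -> 0 < u -> 0 < v ->
  u * alpha + v * beta <> alpha * beta.
Proof.
move=> co u0 v0 e.
have du : beta %| u.
  rewrite -(@Gauss_dvdl beta u alpha) 1?coprime_sym //.
  by rewrite -(@dvdn_addl (v * beta)) ?dvdn_mull // e dvdn_mull.
have ub := dvdn_leq u0 du.
have := leq_mul ub (leqnn alpha).
have b0 : 0 < beta by move: du u0; case: (beta) => //; rewrite dvd0n => /eqP->.
have : 0 < v * beta by rewrite muln_gt0 v0.
lia.
Qed.

(** [beta] divides [u' - u] by coprimality, while [v' > 0] forces
    [u' < beta]. *)
Lemma gap_coords_inj (alpha beta x u v u' v' : nat) :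
  coprime alpha beta -> 0 < beta ->
  gap_coords alpha beta x u v -> gap_coords alpha beta x u' v' ->
  u = u' /\ v = v'.
Proof.
move=> co b0.
wlog le_uu' : u v u' v' / u <= u'.
  move=> H c c'; case: (leqP u u') => [h|/ltnW h]; first exact: H.
  by case: (H u' v' u v h c' c).
move=> [_ v0 e] [_ v'0 e'].
have ub : u' < beta.
  rewrite ltnNge; apply/negP => h; have := leq_mul h (leqnn alpha).
  have : 0 < v' * beta by rewrite muln_gt0 v'0.
  lia.
have d : beta %| u' - u.
  rewrite -(@Gauss_dvdl beta _ alpha) 1?coprime_sym //.
  have -> : (u' - u) * alpha = v * beta - v' * beta by rewrite mulnBl; lia.
  by rewrite dvdn_sub ?dvdn_mull.
have eu : u = u'.
  case: (posnP (u' - u)) => [|h]; first lia.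
  have := dvdn_leq h d; lia.
split=> //; apply/eqP; rewrite -(eqn_pmul2r b0); subst u'; lia.
Qed.

(** Some [m < beta] satisfies [m * alpha = x] modulo [beta].  The sign of
    [x - m * alpha], a multiple of [beta], decides the alternative; in the
    negative case the coordinates are [beta - m] and
    [(m * alpha - x) / beta]. *)
Lemma mem_or_gap_coords (alpha beta x : nat) :
  coprime alpha beta -> 0 < alpha -> 0 < beta ->
  semigroup2 alpha beta x \/ exists u v, gap_coords alpha beta x u v.
Proof.
move=> co a0 b0.
pose y := chinese alpha beta 0 x.
have ya : alpha %| y by rewrite /dvdn /y chinese_modl // mod0n.
have yb : y = x %[mod beta] by rewrite /y chinese_modr.
pose m := (y %/ alpha) %% beta.
have mb : m < beta by rewrite ltn_mod.
have mx : m * alpha = x %[mod beta] by rewrite modnMml divnK.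
case: (leqP (m * alpha) x) => [h|h].
  left; exists m, ((x - m * alpha) %/ beta).
  have d : beta %| x - m * alpha by rewrite -eqn_mod_dvd // mx.
  by rewrite divnK // subnKC.
right; exists (beta - m), ((m * alpha - x) %/ beta).
have d : beta %| m * alpha - x by rewrite -eqn_mod_dvd ?mx // ltnW.
have := leq_mul (ltnW mb) (leqnn alpha).
split; first by rewrite subn_gt0.
  by rewrite divn_gt0 // dvdn_leq // subn_gt0.
rewrite divnK // mulnBl; lia.
Qed.

Lemma gapP (alpha beta x : nat) :
  coprime alpha beta -> 0 < alpha -> 0 < beta ->
  gap (semigroup2 alpha beta) x <-> exists u v, gap_coords alpha beta x u v.
Proof.
move=> co a0 b0; split=> [nx|[u [v [u0 v0 e]]] [m [n xE]]].
  by case: (mem_or_gap_coords x co a0 b0).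
apply: (@mul_neq_pos_comb _ _ (u + m) (v + n) co); rewrite ?addn_gt0 ?u0 ?v0 //.
rewrite -e xE !mulnDl; lia.
Qed.

(** If [x] has coordinates [(u, v)] and [x = m alpha + n beta + g], then
    [(u + m, v + n)] are coordinates of [g], so they equal [(a, b)] by
    uniqueness; conversely the differences [a - u], [b - v] are the coefficients
    of [x - g]. *)
Lemma gap_Delta0P (alpha beta g a b x : nat) :
  coprime alpha beta -> 0 < alpha -> 0 < beta -> gap_coords alpha beta g a b ->
  gap (Delta0 (semigroup2 alpha beta) g) x <->
  exists u v, gap_coords alpha beta x u v /\ ~~ ((u <= a) && (v <= b)).
Proof.
move=> co al0 be0 [a0 b0 eg]; split.
  move=> nD.
  have /(gapP x co al0 be0)[u [v c]] : gap (semigroup2 alpha beta) x.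
    by move=> h; apply: nD; left.
  exists u, v; split=> //; apply/negP => /andP[ua vb]; apply: nD; right.
  have [_ _ e] := c.
  exists ((a - u) * alpha + (b - v) * beta); first by exists (a - u), (b - v).
  have := leq_mul ua (leqnn alpha); have := leq_mul vb (leqnn beta).
  rewrite /= !mulnBl; lia.
move=> [u [v [c nuv]]] [Gx|[y [m [n yE]] /= xE]].
  by apply: (gapP x co al0 be0).2 Gx; exists u, v.
have [u0 v0 e] := c.
have e' : (u + m) * alpha + (v + n) * beta + g = alpha * beta.
  rewrite -e -xE yE !mulnDl; lia.
have c' : gap_coords alpha beta g (u + m) (v + n).
  by split; rewrite ?addn_gt0 ?u0 ?v0 //; lia.
have [ea eb] := gap_coords_inj co be0 c' (And3 a0 b0 eg).
by move: nuv; rewrite -ea -eb !leq_addr.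
Qed.

(** * Counting pairs of coordinates *)

(** The pair [(i, j)] of ordinals stands for the coordinates [(i + 1, j + 1)];
    with this shift the symmetry [(u, v) |-> (beta - u, alpha - v)] is
    [rev_ord] on both components. *)
Definition gap_pairs (alpha beta : nat) : {set 'I_beta.-1 * 'I_alpha.-1} :=
  [set p : 'I_beta.-1 * 'I_alpha.-1 |
    p.1.+1 * alpha + p.2.+1 * beta < alpha * beta].

(** This is Sylvester's count of the gaps: reversing both components maps
    [gap_pairs] onto its complement, because equality
    [u * alpha + v * beta = alpha * beta] never occurs. *)
Lemma card_gap_pairs (alpha beta : nat) :
  coprime alpha beta -> 0 < alpha -> 0 < beta ->
  2 * #|gap_pairs alpha beta| = alpha.-1 * beta.-1.
Proof.
move=> co al0 be0.
pose r (p : 'I_beta.-1 * 'I_alpha.-1) := (rev_ord p.1, rev_ord p.2).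
have rK : involutive r by case=> i j; rewrite /r /= !rev_ordK.
have rC : [set r p | p in gap_pairs alpha beta] = ~: gap_pairs alpha beta.
  apply/setP=> p; rewrite -[p in LHS]rK (mem_imset _ _ (inv_inj rK)).
  rewrite !inE /r /= -leqNgt.
  case: p => i j /=; have li := ltn_ord i; have lj := ltn_ord j.
  have -> : (beta.-1 - i.+1).+1 = beta - i.+1 by lia.
  have -> : (alpha.-1 - j.+1).+1 = alpha - j.+1 by lia.
  have := @mul_neq_pos_comb _ _ i.+1 j.+1 co isT isT.
  have li' : i.+1 <= beta by lia.
  have lj' : j.+1 <= alpha by lia.
  have := leq_mul li' (leqnn alpha); have := leq_mul lj' (leqnn beta).
  rewrite !mulnBl; lia.
have := cardsC (gap_pairs alpha beta).
rewrite -rC card_imset; last exact: inv_inj.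
by rewrite card_prod !card_ord addnn -mul2n => ->; rewrite mulnC.
Qed.

Definition box (m n a b : nat) : {set 'I_m * 'I_n} :=
  [set p : 'I_m * 'I_n | (p.1 < a) && (p.2 < b)].

Lemma card_ord_lt (n a : nat) : a <= n -> #|[set i : 'I_n | i < a]| = a.
Proof.
move=> an; rewrite -sum1_card.
under eq_bigl do rewrite inE.
by rewrite -(big_ord_widen n (fun=> 1) an) sum1_card card_ord.
Qed.

Lemma card_box (m n a b : nat) : a <= m -> b <= n -> #|box m n a b| = a * b.
Proof.
move=> am bn.
have := cardsX [set i : 'I_m | i < a] [set j : 'I_n | j < b].
by rewrite !card_ord_lt // => <-; apply: eq_card => -[i j]; rewrite !inE.
Qed.

(** * Conductor and delta of a cofinite set *)

Local Open Scope classical_set_scope.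

Lemma card_fset_set_seq (D : set nat) (s : seq nat) :
  uniq s -> (forall x, D x <-> x \in s) -> #|` fset_set D| = size s.
Proof.
move=> us Ds.
have -> : D = [set` [fset x in s]%fset].
  by apply/seteqP; split=> x /=; rewrite !inE => /Ds.
by rewrite set_fsetK card_fseq undup_id.
Qed.

Lemma conductor_eq (D : set nat) (c : nat) :
  (forall x, c <= x -> D x) -> (0 < c -> gap D c.-1) -> conductor D = c.
Proof.
move=> Dc nDc.
have fD : finite_set (~` D).
  apply: (@sub_finite_set _ _ `I_c) => [x /= nDx|]; last exact: finite_II.
  by rewrite ltnNge; apply/negP => /Dc.
apply/eqP; rewrite eqn_leq; apply/andP; split.
  apply/bigmax_leqP_seq => x; rewrite in_fset_set // inE => nDx _.
  by rewrite ltnNge; apply/negP => /Dc.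
case: (posnP c) => [->//|c0]; rewrite -[X in X <= _](prednK c0).
apply: (@leq_bigmax_seq _ _ _ succn) => //.
by rewrite in_fset_set // inE; apply: nDc.
Qed.

Lemma delta_add_gaps (D : set nat) (c : nat) :
  conductor D = c -> (forall x, c <= x -> D x) ->
  delta D + #|` fset_set (~` D)| = c.
Proof.
move=> cD Dc; pose P x := `[< D x >].
rewrite /delta cD (@card_fset_set_seq _ [seq x <- iota 0 c | P x]).
- rewrite (@card_fset_set_seq _ [seq x <- iota 0 c | predC P x]).
  + by rewrite !size_filter count_predC size_iota.
  + by rewrite filter_uniq ?iota_uniq.
  + move=> x; rewrite mem_filter mem_iota /= add0n /P; split.
      move=> nDx; apply/andP; split; first by apply/asboolPn.
      by rewrite ltnNge; apply/negP => /Dc.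
    by case/andP => /asboolPn.
- by rewrite filter_uniq ?iota_uniq.
- move=> x; rewrite mem_filter mem_iota /= add0n /P; split.
    by case=> Dx ->; rewrite andbT; apply/asboolP.
  by case/andP => /asboolP.
Qed.

(** * The semimodule generated by 0 and g *)

Lemma gap_coords_bounds (alpha beta x u v : nat) :
  0 < alpha -> 0 < beta -> gap_coords alpha beta x u v ->
  u <= beta.-1 /\ v <= alpha.-1.
Proof.
move=> al0 be0 [u0 v0 e].
have vb : 0 < v * beta by rewrite muln_gt0 v0.
have ua : 0 < u * alpha by rewrite muln_gt0 u0.
have : u * alpha < beta * alpha by lia.
have : v * beta < alpha * beta by lia.
rewrite !ltn_pmul2r //; lia.
Qed.

(** The map from coordinates to gaps is a bijection from [gap_pairs] minus the
    box onto the complement of [Delta0]; the box lies inside [gap_pairs] because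
    its corner [(a, b)] does. *)
Lemma card_gaps_Delta0 (alpha beta g a b : nat) :
  coprime alpha beta -> 0 < alpha -> 0 < beta -> gap_coords alpha beta g a b ->
  2 * (#|` fset_set (~` Delta0 (semigroup2 alpha beta) g)| + a * b) =
  alpha.-1 * beta.-1.
Proof.
move=> co al0 be0 cg; have [a0 b0 eg] := cg.
have [ab bb] := gap_coords_bounds al0 be0 cg.
rewrite -(card_gap_pairs co al0 be0); congr (2 * _).
pose B := box beta.-1 alpha.-1 a b.
have BT : B \subset gap_pairs alpha beta.
  apply/fintype.subsetP => -[i j]; rewrite !inE /= => /andP[ia jb].
  have := leq_mul ia (leqnn alpha); have := leq_mul jb (leqnn beta).
  have := @mul_neq_pos_comb _ _ i.+1 j.+1 co isT isT; lia.
rewrite -(cardsID B (gap_pairs alpha beta)) (finset.setIidPr BT) card_box //.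
rewrite addnC; congr (_ + _).
pose f (p : 'I_beta.-1 * 'I_alpha.-1) :=
  alpha * beta - (p.1.+1 * alpha + p.2.+1 * beta).
have fc p : p \in gap_pairs alpha beta ->
    gap_coords alpha beta (f p) p.1.+1 p.2.+1.
  by rewrite inE /f => h; split; rewrite // -addnA subnK // ltnW.
rewrite (@card_fset_set_seq _ [seq f p | p in gap_pairs alpha beta :\: B]).
- by rewrite size_map -cardE.
- rewrite map_inj_in_uniq ?enum_uniq // => p q.
  rewrite !mem_enum !inE => /andP[_ hp] /andP[_ hq] e.
  have cp : gap_coords alpha beta (f p) p.1.+1 p.2.+1 by apply: fc; rewrite inE.
  have cq : gap_coords alpha beta (f p) q.1.+1 q.2.+1.
    by rewrite e; apply: fc; rewrite inE.
  have [[e1] [e2]] := gap_coords_inj co be0 cp cq.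
  by case: p q e1 e2 {hp hq e cp cq} => i j [i' j'] /= /val_inj-> /val_inj->.
- move=> x; apply: (iff_trans (gap_Delta0P x co al0 be0 cg)).
  split=> [[u [v [cx nuv]]]|/fintype.imageP[p]].
    have [ub vb] := gap_coords_bounds al0 be0 cx.
    have [u0 v0 ex] := cx.
    have iP : u.-1 < beta.-1 by lia.
    have jP : v.-1 < alpha.-1 by lia.
    apply/fintype.imageP; exists (Ordinal iP, Ordinal jP); last first.
      by rewrite /f /= !prednK // -ex -addnA addnK.
    (* [gap_pairs] asks for a strict inequality, so [x = 0] must be excluded. *)
    have xpos : x <> 0.
      by move=> x0; apply: (mul_neq_pos_comb co u0 v0); rewrite -ex x0.
    by rewrite !inE /= !prednK // nuv; lia.
  rewrite inE => /andP[pB /fc cp] ->; exists p.1.+1, p.2.+1; split=> //.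
  by rewrite inE in pB.
Qed.

(** Outside the box, [alpha beta - u alpha - v beta] is largest at [(a + 1, 1)]
    or [(1, b + 1)], where its value is [c - 1].  The equation is
    additive to avoid truncated subtraction; [0 < g] gives
    [2 min (a alpha) (b beta) < alpha beta], which makes the value of [c]
    nonnegative. *)
Lemma Delta0_conductor (alpha beta g a b : nat) :
  coprime alpha beta -> 1 < alpha -> 1 < beta -> gap_coords alpha beta g a b ->
  0 < g ->
  exists c, [/\
    c + alpha + beta + minn (a * alpha) (b * beta) = (alpha * beta).+1,
    forall x, c <= x -> Delta0 (semigroup2 alpha beta) g x &
    conductor (Delta0 (semigroup2 alpha beta) g) = c].
Proof.
move=> co al1 be1 cg g0; have [a0 b0 eg] := cg.
have al0 := ltnW al1; have be0 := ltnW be1.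
have le : alpha + beta + minn (a * alpha) (b * beta) <= (alpha * beta).+1.
  (* The inequality below is [0 <= (alpha - 2) (beta - 2)]. *)
  suff : 2 * alpha + 2 * beta <= alpha * beta + 4 by lia.
  by case: alpha beta al1 be1 {co cg eg al0 be0} => [|[|p]] [|[|q]] // _ _; nia.
pose c := (alpha * beta).+1 - (alpha + beta + minn (a * alpha) (b * beta)).
have cE : c + alpha + beta + minn (a * alpha) (b * beta) = (alpha * beta).+1.
  by rewrite /c; lia.
have Dc x : c <= x -> Delta0 (semigroup2 alpha beta) g x.
  move=> cx; apply: contrapT.
  move=> /(gap_Delta0P x co al0 be0 cg)[u [v [[u0 v0 e] nuv]]].
  have hu := leq_mul u0 (leqnn alpha); have hv := leq_mul v0 (leqnn beta).
  move: nuv; rewrite negb_and -!ltnNge => /orP[h|h].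
    by have := leq_mul h (leqnn alpha); lia.
  by have := leq_mul h (leqnn beta); lia.
exists c; split=> //; apply: conductor_eq => // c0.
apply/(gap_Delta0P _ co al0 be0 cg).
case: (leqP (a * alpha) (b * beta)) => h.
  by exists a.+1, 1; split; [split=> //; lia|rewrite ltnn].
by exists 1, b.+1; split; [split=> //; lia|rewrite ltnn andbF].
Qed.

(** Write [x = g + m alpha + n beta].  If both [m < a] and [n < b], then [x] has
    the coordinates [(a - m, b - n)], so it is a gap; otherwise
    [x >= g + a alpha] or [x >= g + b beta]. *)
Lemma Syz0_min (alpha beta g a b x : nat) :
  coprime alpha beta -> gap_coords alpha beta g a b ->
  Syz0 (semigroup2 alpha beta) g x -> g + minn (a * alpha) (b * beta) <= x.
Proof.
move=> co [a0 b0 eg] [[p [q xpq]] [y [m [n yE]] /= yx]].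
case: (leqP a m) => [am|ma]; first by have := leq_mul am (leqnn alpha); lia.
case: (leqP b n) => [bn|nb]; first by have := leq_mul bn (leqnn beta); lia.
exfalso; apply: (@mul_neq_pos_comb _ _ (a - m + p) (b - n + q) co); lia.
Qed.

(** [g + a alpha = (alpha - b) beta] and [g + b beta = (beta - a) alpha]. *)
Lemma Syz0_min_mem (alpha beta g a b : nat) :
  0 < alpha -> 0 < beta -> gap_coords alpha beta g a b ->
  Syz0 (semigroup2 alpha beta) g (g + minn (a * alpha) (b * beta)).
Proof.
move=> al0 be0 cg; have [a0 b0 eg] := cg.
have [ab bb] := gap_coords_bounds al0 be0 cg.
have hb : b * beta <= alpha * beta by rewrite leq_mul2r; lia.
have ha : a * alpha <= beta * alpha by rewrite leq_mul2r; lia.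
case: leqP => h; split.
- by exists 0, (alpha - b); rewrite mulnBl; lia.
- by exists (a * alpha); [exists a, 0; lia|rewrite /=; lia].
- by exists (beta - a), 0; rewrite mulnBl; lia.
- by exists (b * beta); [exists 0, b; lia|rewrite /=; lia].
Qed.

(** As [0] is in the semigroup, the generators lie in [D], and every element of
    [D] is at least one of them: their minimum is the least element of [D]. *)
Lemma generates_minn (alpha beta h0 h1 m : nat) (D : set nat) :
  generates (semigroup2 alpha beta) [set h0; h1] D ->
  D m -> (forall x, D x -> m <= x) -> minn h0 h1 = m.
Proof.
move=> gD Dm mD.
have G0 : semigroup2 alpha beta 0 by exists 0, 0.
have D0 : D h0 by rewrite gD; exists h0; [left|exists 0].
have D1 : D h1 by rewrite gD; exists h1; [right|exists 0].
have := mD _ D0; have := mD _ D1.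
by move: Dm; rewrite gD => -[x /= [->|->] [y _ /=]]; lia.
Qed.

(** * The Wilf number *)

Local Open Scope ring_scope.
Unset Implicit Arguments.

Theorem proposition3p3 (alpha beta : nat)
  (halpha : (2 <= alpha)%N) (hlt : (alpha < beta)%N)
  (hco : coprime alpha beta)
  (g a b : nat) (ha : (1 <= a)%N) (hb : (1 <= b)%N)
  (hgap : gap (semigroup2 alpha beta) g)
  (hg : g%:Z = alpha%:Z * beta%:Z - a%:Z * alpha%:Z - b%:Z * beta%:Z)
  (h0 h1 : nat)
  (hsyz : minimal_generators (semigroup2 alpha beta) [set h0; h1]
            (Syz0 (semigroup2 alpha beta) g)) :
  let m := (minn h0 h1)%:Z in
  let W := wilf (semigroup2 alpha beta) g in
  [/\ m = alpha%:Z * beta%:Z - b%:Z * beta%:Z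
        \/ m = alpha%:Z * beta%:Z - a%:Z * alpha%:Z,
      m = alpha%:Z * beta%:Z - b%:Z * beta%:Z ->
        - W = a%:Z * alpha%:Z - 2 * a%:Z * b%:Z
    & m = alpha%:Z * beta%:Z - a%:Z * alpha%:Z ->
        - W = b%:Z * beta%:Z - 2 * a%:Z * b%:Z].
Proof.
have al0 : (0 < alpha)%N by lia.
have be1 : (1 < beta)%N by lia.
have be0 := ltnW be1.
have eg : (g + a * alpha + b * beta = alpha * beta)%N by lia.
have cg : gap_coords alpha beta g a b by [].
have g0 : (0 < g)%N.
  by case: (posnP g) hgap => // ->; case; exists 0%N, 0%N.
have mE := generates_minn hsyz.1 (Syz0_min_mem al0 be0 cg)
  (fun x => @Syz0_min _ _ _ _ _ x hco cg).
have [c [cE Dc condE]] := Delta0_conductor hco halpha be1 cg g0.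
have dE := delta_add_gaps condE Dc.
have nE := card_gaps_Delta0 hco al0 be0 cg.
(* the product of the predecessors, freed from truncated subtraction *)
have pE : (alpha.-1 * beta.-1 + alpha + beta = (alpha * beta).+1)%N.
  by case: (alpha) (beta) al0 be0 => [|p] [|q] // _ _ /=; nia.
move=> m W; rewrite /W /wilf condE {W} /m mE {m}.
split; lia.
Qed.
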